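(* Let $p,q\in(1,\infty)$ and $k\in[0,1)$. Then $$p\,\mathcal{E}_{p,q}(k^{\frac1q})\,\mathcal{K}_{q,p}(k^{\frac1p}) - q\,\mathcal{K}_{p,q}(k^{\frac1q})\,\mathcal{E}_{q,p}(k^{\frac1p}) = \frac{(p-q)\,\pi_{p,q}\,\pi_{q,p}}{4}.$$
   Context: For $p,q\in(1,\infty)$ and $k\in[0,1)$, $$\pi_{p,q}:=2\int_0^1\frac{dt}{(1-t^q)^{\frac1p}},$$ the complete $(p,q)$-elliptic integral of the first kind is $$\mathcal{K}_{p,q}(k):=\int_0^1\frac{dt}{(1-t^q)^{\frac1p}(1-k^qt^q)^{1-\frac1p}},$$ and the complete $(p,q)$-elliptic integral of the second kind is $$\mathcal{E}_{p,q}(k):=\int_0^1\left(\frac{1-k^qt^q}{1-t^q}\right)^{\frac1p}dt.$$ The quantities $\pi_{q,p},\mathcal{K}_{q,p},\mathcal{E}_{q,p}$ are obtained by interchanging the roles of $p$ and $q$. *)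

(* Defs.v *)
From mathcomp Require Import all_boot all_order all_algebra.
From mathcomp Require Import all_classical all_reals all_analysis.

Set Implicit Arguments.
Unset Strict Implicit.
Unset Printing Implicit Defensive.

Import Order.TTheory GRing.Theory Num.Theory.

Local Open Scope classical_set_scope.
Local Open Scope ring_scope.

(* The integrals are real-valued Lebesgue integrals over [0, 1]. The integrands
   are singular at t = 1, where the conventions of powR and of the inverse
   give them a value that is irrelevant since a point has measure 0. For
   1 < p, 1 < q and 0 <= k < 1 they are nonnegative and integrable. *)

Definition pi_pq (R : realType) (p q : R) : R :=
  2 * \int[lebesgue_measure]_(t in `[0, 1]) ((1 - t `^ q) `^ p^-1)^-1.

Definition ellK (R : realType) (p q k : R) : R :=
  \int[lebesgue_measure]_(t in `[0, 1])
    ((1 - t `^ q) `^ p^-1 * (1 - k `^ q * t `^ q) `^ (1 - p^-1))^-1.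

Definition ellE (R : realType) (p q k : R) : R :=
  \int[lebesgue_measure]_(t in `[0, 1])
    ((1 - k `^ q * t `^ q) / (1 - t `^ q)) `^ p^-1.

(* Main.v *)
Require Import Defs.
From mathcomp Require Import all_boot all_order all_algebra.
From mathcomp Require Import all_classical all_reals all_analysis.
From mathcomp Require Import measurable_realfun ring lra.

Set Implicit Arguments.
Unset Strict Implicit.
Unset Printing Implicit Defensive.

Import Order.TTheory GRing.Theory Num.Theory.
Import numFieldNormedType.Exports.

Local Open Scope classical_set_scope.
Local Open Scope ring_scope.

(** Put x = k. With u = 1 - t^q, v = 1 - x t^q and b = 1/p, the integrals
    E_(p,q)(x^(1/q)) and K_(p,q)(x^(1/q)) are
      A = int_0^1 u^(-b) v^b dt    and    B = int_0^1 u^(-b) v^(b-1) dt,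
    and C, D denote the analogous integrals with p and q exchanged. The left-hand
    side of the identity is W(x) = p A D - q B C, and as in the classical
    Legendre relation, the proof shows that W is constant in x.

    Differentiating under the integral sign (is_derive_powR_kernel) and writing
    x t^q = 1 - v gives x A' = (A - B) / p, and an expression of x B' through
    the integrals with exponents b - 1 and b - 2 (is_derive_euler_int).
    Integrating the derivative of t u^(1-b) v^(b-1), which vanishes at both ends,
    gives a linear relation between the exponents b, b - 1 and b - 2
    (euler_int_contiguous), hence
      x B' = (A / (1 - x) - B) / q    (is_derive_euler_int_contiguous).
    With the same formulas for C and D, all terms of x W' cancel
    (is_derive_legendre_form), so W(k) = W(0) (legendre_form_cst). At x = 0 one
    has A = B = pi_(p,q)/2 and C = D = pi_(q,p)/2, which is the right-hand side.

    The weight u^(-b) is singular at t = 1. Its integrability follows by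
    comparison with (1 - t)^(-b), and the integration by parts uses a version of
    the fundamental theorem of calculus for integrands that are merely integrable
    up to the endpoints (Rintegral_FTC_integrable). *)

(** * Real powers *)

Lemma powR_mulB1 (R : realType) (s a : R) : 0 < s -> s `^ a = s * s `^ (a - 1).
Proof.
move=> s0; rewrite -{2}(powRr1 (ltW s0)) -powRD; last by rewrite (gt_eqF s0) implybT.
by congr (_ `^ _); ring.
Qed.

Lemma powR_lt1 (R : realType) (q t : R) :
  0 < q -> 0 < t -> t < 1 -> t `^ q < 1.
Proof.
move=> q0 t0 t1; have := @gt0_ltr_powR _ q q0 t 1.
by rewrite powR1; apply => //; rewrite nnegrE; [exact: ltW|exact: ler01].
Qed.

(** A power function is monotone, but its direction depends on the sign of the
    exponent; summing both endpoint values gives a bound for every exponent,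
    which is all that domination needs. *)
Lemma powR_le_endpoints (R : realType) (a s b alpha : R) :
  0 < a -> a <= s <= b -> s `^ alpha <= a `^ alpha + b `^ alpha.
Proof.
move=> a0 /andP[as_ sb].
have s0 : 0 < s := lt_le_trans a0 as_.
have b0 : 0 < b := lt_le_trans s0 sb.
have [al0|al0] := leP 0 alpha.
  rewrite (@le_trans _ _ (b `^ alpha))// ?lerDr ?powR_ge0//.
  by apply: ge0_ler_powR => //; rewrite nnegrE; exact: ltW.
rewrite (@le_trans _ _ (a `^ alpha))// ?lerDl ?powR_ge0//.
rewrite -(opprK alpha) !(powRN _ (- alpha)) lef_pV2 ?posrE ?powR_gt0//.
by apply: ge0_ler_powR => //; rewrite ?nnegrE ?oppr_ge0; exact: ltW.
Qed.

Lemma is_derive_powR_comp (R : realType) (u : R -> R) (a x du : R) :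
  0 < u x -> is_derive x 1 u du ->
  is_derive x 1 (fun t => u t `^ a) (a * u x `^ (a - 1) * du).
Proof.
move=> ux dux; exact: (is_derive1_comp (is_derive1_powR a ux) dux).
Qed.

Lemma cvg_powR_comp (R : realType) (T : Type) (E : set_system T)
    {FE : Filter E} (u : T -> R) (a l : R) : 0 < l ->
  u x @[x --> E] --> l -> u x `^ a @[x --> E] --> l `^ a.
Proof.
move=> l0 ul; apply: (@cvg_comp _ _ _ u (fun y => y `^ a) E (nbhs l) (nbhs (l `^ a)) ul).
have : {for l, continuous (fun y : R => y `^ a)}.
  apply: differentiable_continuous; apply/derivable1_diffP.
  by apply: derivable_powR; rewrite in_itv/= l0.
exact.
Qed.

(** powR takes the value 1 at negative bases, so it is continuous at 0 from the
    right only; hence the positivity of u. *)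
Lemma cvg_powR_comp0 (R : realType) (T : Type) (E : set_system T)
    {FE : Filter E} (u : T -> R) (a : R) : 0 < a ->
  (\forall x \near E, 0 < u x) ->
  u x @[x --> E] --> 0 -> u x `^ a @[x --> E] --> 0.
Proof.
move=> a0 u0 ul.
have ur : u x @[x --> E] --> 0^'+.
  by move=> A /ul; apply: filterS2 u0 => x u0; exact.
exact: (@cvg_comp _ _ _ u (fun y => y `^ a) E _ _ ur (powR_cvg0 a0)).
Qed.

Lemma is_derive_powR_onem (R : realType) (a x : R) : x < 1 ->
  is_derive x 1 (fun t => (1 - t) `^ a) (- (a * (1 - x) `^ (a - 1))).
Proof.
move=> x1; have x0 : 0 < 1 - x by lra.
have d1 : is_derive x 1 (fun t : R => 1 - t) (-1).
  by have := is_deriveB (is_derive_cst (1 : R) x 1) (is_derive_id x 1); rewrite sub0r.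
by have := @is_derive_powR_comp _ (fun t => 1 - t) a x _ x0 d1; rewrite mulrN1.
Qed.

(** * Integrability and the fundamental theorem with singular endpoints *)

Lemma integrable_EFinB (R : realType) d (T : measurableType d)
    (mu : {measure set T -> \bar R}) (D : set T) (f g : T -> R) :
  measurable D ->
  mu.-integrable D (EFin \o f) -> mu.-integrable D (EFin \o g) ->
  mu.-integrable D (EFin \o (fun t => f t - g t)).
Proof. by move=> mD intf intg; have := integrableB mD intf intg. Qed.

Lemma integrable_EFinZl (R : realType) d (T : measurableType d)
    (mu : {measure set T -> \bar R}) (D : set T) (f : T -> R) (c : R) :
  measurable D ->
  mu.-integrable D (EFin \o f) -> mu.-integrable D (EFin \o (fun t => c * f t)).
Proof. by move=> mD intf; have := integrableZl mD c intf. Qed.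

(** Integrability replaces continuity of the integrand at the endpoints: F and
    the indefinite integral of f have the same derivative inside the interval
    and both are continuous up to its ends, so the mean value theorem makes
    their difference constant. *)
Lemma Rintegral_FTC_integrable (R : realType) (f F : R -> R) (a b : R) :
  a < b ->
  (@lebesgue_measure R).-integrable `[a, b] (EFin \o f) ->
  {in `]a, b[, continuous f} ->
  (forall x, x \in `]a, b[ -> is_derive x 1 F (f x)) ->
  {within `[a, b], continuous F} ->
  \int[lebesgue_measure]_(x in `[a, b]) f x = F b - F a.
Proof.
move=> ab intf cf dF cF.
set mu := @lebesgue_measure R.
pose H x := parameterized_integral mu a x f.
have cH : {within `[a, b], continuous H}.
  exact: parameterized_integral_continuous (ltW ab) intf.
have dH x : x \in `]a, b[ -> is_derive x 1 H (f x).
  move=> xab; have /andP[ax xb] : a < x < b by rewrite in_itv in xab.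
  have [dHx Hx] := continuous_FTC1_closed xb intf ax (cf _ xab).
  by split; [exact: dHx|rewrite -derive1E; exact: Hx].
have [||c _] := @MVT R (F - H) (cst 0) a b ab.
- move=> x xab; apply: is_derive_eq; first exact: (is_deriveB (dF _ xab) (dH _ xab)).
  by rewrite subrr.
- move=> x; apply: (@continuousD _ _ (subspace `[a, b]) F (- H)); first exact: cF.
  by apply: continuousN; exact: cH.
have Ha : H a = 0 by rewrite /H /parameterized_integral set_itv1 Rintegral_set1.
rewrite mul0r -[(F - H) b]/(F b - H b) -[(F - H) a]/(F a - H a) Ha => FH.
by rewrite -[LHS]/(H b); lra.
Qed.

(** The model singularity at 1. By monotone convergence it is enough to bound
    the integrals over the intervals from 0 to 1 - 1/n, where the usual
    primitive applies and gives at most 1/(a+1). *)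
Lemma integrable_powR_onem (R : realType) (a : R) : -1 < a ->
  (@lebesgue_measure R).-integrable `[0, 1] (EFin \o (fun t => (1 - t) `^ a)).
Proof.
move=> a1.
set mu := @lebesgue_measure R.
have a0 : 0 < a + 1 by lra.
pose f (t : R) := (1 - t) `^ a.
have mf (D : set (measurableTypeR R)) : measurable_fun D f.
  apply: (@measurableT_comp _ _ _ _ _ _ (fun y : R => y `^ a)) => //.
  exact: measurable_funB.
apply/integrableP; split; first by apply/measurable_EFinP; exact: mf.
under eq_integral do rewrite /comp abse_EFin ger0_norm ?powR_ge0//.
rewrite -integral_itv_bndo_bndc; last by apply/measurable_EFinP; exact: mf.
rewrite itv_bnd_open_bigcup.
apply: (@le_lt_trans _ _ ((a + 1)^-1)%:E); last exact: ltry.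
pose D (n : nat) := `[0 : R, 1 - n.+1%:R^-1]%classic.
have cvgD : (\int[mu]_(x in D n) ((1 - x) `^ a)%:E)%E @[n --> \oo] -->
    (\int[mu]_(x in \bigcup_n D n) ((1 - x) `^ a)%:E)%E.
  apply: ge0_nondecreasing_set_cvg_integral.
  - move=> m n mn; apply/subsetPset => t; rewrite /D /= !in_itv/=.
    move=> /andP[-> /le_trans]; apply.
    by rewrite lerD2l lerN2 lef_pV2 ?posrE ?ltr0n// ler_nat.
  - by move=> n; exact: measurable_itv.
  - by move=> n; apply/measurable_EFinP; exact: mf.
  - by move=> n x _; rewrite lee_fin powR_ge0.
rewrite -(cvg_lim _ cvgD)//.
apply: lime_le; first by apply/cvg_ex; eexists; exact: cvgD.
(* For n = 0 the interval is reduced to the point 0. *)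
near=> n.
have n2 : n.+1%:R^-1 < 1 :> R.
  rewrite invf_lt1 ?ltr0n// ltr1n ltnS.
  by near: n; exact: nbhs_infty_gt.
have n0 : 0 < n.+1%:R^-1 :> R by rewrite invr_gt0 ltr0n.
pose F (t : R) := - ((a + 1)^-1 * (1 - t) `^ (a + 1)).
have dF (x : R) : x < 1 -> is_derive x 1 F ((1 - x) `^ a).
  move=> x1.
  have := is_deriveN (is_deriveZ (a + 1)^-1 (is_derive_powR_onem (a + 1) x1)).
  rewrite addrK => dd; apply: (is_derive_eq dd).
  by rewrite scalerN opprK; apply: mulKf; rewrite gt_eqF.
have cF (x : R) : x < 1 -> {for x, continuous F}.
  move=> /dF[dFx _].
  exact/differentiable_continuous/derivable1_diffP.
rewrite (@continuous_FTC2 _ _ F) ?lee_fin /F//=; first last.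
- move=> x; rewrite in_itv/= => /andP[x0 x1].
  have xx : x < 1 by rewrite (lt_le_trans x1)// gerBl ltW.
  by have /@derive_val := dF _ xx; rewrite derive1E.
- split.
  + move=> x; rewrite in_itv/= => /andP[x0 x1].
    have xx : x < 1 by rewrite (lt_le_trans x1)// gerBl ltW.
    by have := dF _ xx => -[].
  + by apply: cvg_at_right_filter; exact: cF ltr01.
  + by apply: cvg_at_left_filter; apply: cF; rewrite gtrBl.
- apply: derivable_within_continuous => x; rewrite in_itv/= => /andP[x0 x1].
  have x1' : x < 1 by rewrite (le_lt_trans x1)// gtrBl.
  by have [] := is_derive_powR_onem a x1'.
- by rewrite subr_gt0.
rewrite subr0 powR1 mulr1 opprK gerDr oppr_le0 mulr_ge0 ?powR_ge0// invr_ge0.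
exact: ltW.
Unshelve. all: by end_near. Qed.

(** * Differentiation of an integral of powers of 1 - x y(t) *)

Lemma onem_mul_bounds (R : realType) (x y r : R) :
  `|x| <= r -> 0 <= y <= 1 -> 1 - r <= 1 - x * y <= 1 + r.
Proof.
move=> xr /andP[y0 y1].
have : `|x * y| <= r.
  by rewrite normrM (ger0_norm y0) (le_trans _ xr)// ler_piMr.
by rewrite ler_norml => /andP[? ?]; apply/andP; split; lra.
Qed.

Lemma integrable_powR_kernel (R : realType) d (T : measurableType d)
    (mu : {measure set T -> \bar R}) (D : set T) (w y : T -> R) (alpha x : R) :
  measurable D -> mu.-integrable D (EFin \o w) -> measurable_fun D y ->
  (forall t, D t -> 0 <= y t <= 1) -> `|x| < 1 ->
  mu.-integrable D (EFin \o (fun t => w t * (1 - x * y t) `^ alpha)).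
Proof.
move=> mD intw my y01 x1; pose C := (1 - `|x|) `^ alpha + (1 + `|x|) `^ alpha.
have mw : measurable_fun D w by apply/measurable_EFinP/(measurable_int mu).
apply: (@le_integrable _ _ _ mu D _ _ (fun t => (C%:E * (w t)%:E)%E)) => //.
- apply/measurable_EFinP; apply: measurable_funM => //.
  apply: (@measurableT_comp _ _ _ _ _ _ (fun s : R => s `^ alpha)) => //.
  by apply: measurable_funB => //; exact: measurable_funM.
- move=> t Dt; rewrite -EFinM !abse_EFin lee_fin !normrM mulrC.
  rewrite ler_wpM2r// ger0_norm ?powR_ge0// ger0_norm ?addr_ge0 ?powR_ge0//.
  apply: powR_le_endpoints; first by rewrite subr_gt0.
  exact: onem_mul_bounds (y01 _ Dt).
- exact: integrableZl.
Qed.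

(** For |z| < r < 1, the base 1 - z y(t) stays between
    the positive numbers 1 - r and 1 + r, so the derivative of the integrand in
    z is dominated by a constant multiple of |w|, uniformly in z. *)
Lemma is_derive_powR_kernel (R : realType) d (T : measurableType d)
    (mu : {measure set T -> \bar R}) (D : set T) (w y : T -> R) (alpha x : R) :
  measurable D -> mu.-integrable D (EFin \o w) -> measurable_fun D y ->
  (forall t, D t -> 0 <= y t <= 1) -> `|x| < 1 ->
  is_derive x 1 (fun x => \int[mu]_(t in D) (w t * (1 - x * y t) `^ alpha))
    (\int[mu]_(t in D) (w t * - (alpha * y t * (1 - x * y t) `^ (alpha - 1)))).
Proof.
move=> mD intw my y01 x1.
(* Any radius strictly between |x| and 1 works. *)
pose r := (1 + `|x|) / 2.
have xr : `|x| < r by rewrite /r; lra.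
have r1 : r < 1 by rewrite /r; lra.
pose f x t := w t * (1 - x * y t) `^ alpha.
pose C := `|alpha| * ((1 - r) `^ (alpha - 1) + (1 + r) `^ (alpha - 1)).
have Ir z : `]- r, r[%classic z -> `|z| < r by rewrite /= in_itv/= ltr_norml.
have df (z : R) t : `|z| < r -> D t ->
    is_derive z 1 (f^~ t) (w t * - (alpha * y t * (1 - z * y t) `^ (alpha - 1))).
  move=> zr Dt.
  have /andP[v0 _] := onem_mul_bounds (ltW zr) (y01 _ Dt).
  have {}v0 : 0 < 1 - z * y t by rewrite (lt_le_trans _ v0)// subr_gt0.
  have dv : is_derive z 1 (fun z => 1 - z * y t) (- y t).
    have -> : (fun z => 1 - z * y t) = (fun z => 1 - y t * z).
      by apply/funext => s; rewrite mulrC.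
    apply: (is_derive_eq (is_deriveB (is_derive_cst (1 : R) z 1)
      (is_deriveZ (y t) (is_derive_id z 1)))).
    by rewrite sub0r /GRing.scale/= mulr1.
  apply: (is_derive_eq (is_deriveZ (w t)
    (@is_derive_powR_comp _ (fun z => 1 - z * y t) alpha z _ v0 dv))).
  by rewrite /GRing.scale/=; ring.
have Ix : `]- r, r[%classic x by rewrite /= in_itv/= -ltr_norml.
have intf z : `]- r, r[%classic z -> mu.-integrable D (EFin \o f z).
  by move=> /Ir zr; apply: integrable_powR_kernel => //; exact: lt_trans zr r1.
have derf (z : R) t : `]- r, r[%classic z -> D t -> derivable (f^~ t) z 1.
  by move=> /Ir zr Dt; have [] := df z t zr Dt.
have d1f z t : `]- r, r[%classic z -> D t -> partial1of2 f z t =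
    w t * - (alpha * y t * (1 - z * y t) `^ (alpha - 1)).
  move=> /Ir zr Dt; rewrite partial1of2E.
  by have /@derive_val := df z t zr Dt.
have G_ge0 t : 0 <= C * `|w t|.
  by rewrite mulr_ge0// mulr_ge0// addr_ge0// powR_ge0.
have intG : mu.-integrable D (EFin \o (fun t => C * `|w t|)).
  have := integrableZl mD C (integrable_norm intw).
  exact.
have G_ub z t : `]- r, r[%classic z -> D t -> `|partial1of2 f z t| <= C * `|w t|.
  move=> zr Dt; rewrite d1f// mulrC normrM normrN ler_wpM2r//.
  have /andP[y0 y1] := y01 _ Dt.
  rewrite !normrM /C -mulrA ler_wpM2l// (ger0_norm y0).
  rewrite (le_trans (ler_piMl _ _))// ger0_norm ?powR_ge0//.
  apply: powR_le_endpoints; first by rewrite subr_gt0.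
  by apply: onem_mul_bounds (y01 _ Dt); exact/ltW/Ir.
apply: DeriveDef.
  exact: (derivable_under_integral mD Ix intf derf G_ge0 intG G_ub).
rewrite -derive1E.
rewrite (differentiation_under_integral mD Ix intf derf G_ge0 intG G_ub).
by apply: eq_Rintegral => t /set_mem Dt; exact: d1f.
Qed.

(** * The Euler integrals behind K and E *)

Lemma powR_itv01 (R : realType) (q t : R) :
  0 <= q -> `[0%R : R, 1%R]%classic t -> 0 <= t `^ q <= 1.
Proof.
move=> q0; rewrite /= in_itv/= => /andP[t0 t1]; rewrite powR_ge0/=.
have := @ge0_ler_powR _ q q0 t 1; rewrite powR1; apply => //.
by rewrite nnegrE.
Qed.

(** Since q > 1, t^q <= t on the unit interval, which compares the weight with
    the model singularity (1 - t)^(- b). *)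
Lemma integrable_powR_onem_powR (R : realType) (q b : R) : 1 < q -> 0 < b -> b < 1 ->
  (@lebesgue_measure R).-integrable `[0, 1] (EFin \o (fun t => (1 - t `^ q) `^ (- b))).
Proof.
move=> q1 b0 b1; have ab : -1 < - b by lra.
apply: (le_integrable _ _ _ (integrable_powR_onem ab)) => //.
- apply/measurable_EFinP.
  apply: (@measurableT_comp _ _ _ _ _ _ (fun s : R => s `^ (- b))) => //.
  apply: measurable_funB => //.
  exact: measurable_funS (measurable_powR q).
- move=> t t01 /=; rewrite lee_fin !ger0_norm ?powR_ge0//.
  have := t01; rewrite /= in_itv/= => /andP[t0].
  rewrite le_eqVlt => /predU1P[->|t1]; first by rewrite powR1 subrr.
  have tq : t `^ q <= t.
    have [->|tn0] := eqVneq t 0; first by rewrite powR0// gt_eqF//; lra.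
    by apply: ge1r_powR; [rewrite lt_neqAle eq_sym tn0 t0 ltW|exact: ltW].
  rewrite !powRN lef_pV2 ?posrE ?powR_gt0//; [|lra..].
  by apply: ge0_ler_powR; rewrite ?nnegrE; lra.
Qed.

(** Substituting s = t^q turns this into Euler's integral for the hypergeometric
    function F(- alpha, 1/q; 1 + 1/q - b; x), up to a constant factor. With
    b = 1/p, the exponents alpha = b and alpha = b - 1 give the integrals of
    the second and of the first kind at modulus x^(1/q). *)
Definition euler_int (R : realType) (q b alpha x : R) : R :=
  \int[lebesgue_measure]_(t in `[0, 1]) ((1 - t `^ q) `^ (- b) * (1 - x * t `^ q) `^ alpha).

Lemma integrable_euler_int (R : realType) (q b alpha x : R) :
  1 < q -> 0 < b -> b < 1 -> `|x| < 1 ->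
  (@lebesgue_measure R).-integrable `[0, 1]
    (EFin \o (fun t => (1 - t `^ q) `^ (- b) * (1 - x * t `^ q) `^ alpha)).
Proof.
move=> q1 b0 b1 x1.
apply: (@integrable_powR_kernel _ _ _ (@lebesgue_measure R) `[0, 1] _
  (fun t => t `^ q)) => //.
- exact: integrable_powR_onem_powR.
- exact: measurable_funS (measurable_powR q).
- by move=> t; apply: powR_itv01; lra.
Qed.

Lemma onem_mul_powR_gt0 (R : realType) (q x t : R) :
  0 <= q -> `|x| < 1 -> `[0%R : R, 1%R]%classic t -> 0 < 1 - x * t `^ q.
Proof.
move=> q0 x1 t01; have /andP[+ _] := onem_mul_bounds (lexx `|x|) (powR_itv01 q0 t01).
by apply: lt_le_trans; rewrite subr_gt0.
Qed.

Lemma is_derive_euler_int_under (R : realType) (q b alpha x : R) :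
  1 < q -> 0 < b -> b < 1 -> `|x| < 1 ->
  is_derive x 1 (euler_int q b alpha)
    (\int[lebesgue_measure]_(t in `[0, 1]) ((1 - t `^ q) `^ (- b) *
       - (alpha * t `^ q * (1 - x * t `^ q) `^ (alpha - 1)))).
Proof.
move=> q1 b0 b1 x1.
apply: (@is_derive_powR_kernel _ _ _ (@lebesgue_measure R) `[0, 1] _
  (fun t => t `^ q)) => //.
- exact: integrable_powR_onem_powR.
- exact: measurable_funS (measurable_powR q).
- by move=> t; apply: powR_itv01; lra.
Qed.

(** Multiplying the derivative under the integral sign by x allows replacing
    x t^q by 1 - (1 - x t^q), which expresses it through the two neighbouring
    exponents; this is why x = 0 is excluded. *)
Lemma is_derive_euler_int (R : realType) (q b alpha x : R) :
  1 < q -> 0 < b -> b < 1 -> `|x| < 1 -> x != 0 ->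
  is_derive x 1 (euler_int q b alpha)
    (alpha * (euler_int q b alpha x - euler_int q b (alpha - 1) x) / x).
Proof.
move=> q1 b0 b1 x1 xn0; have q0 : 0 <= q by lra.
apply: (is_derive_eq (@is_derive_euler_int_under _ q b alpha x q1 b0 b1 x1)).
have iM := @integrable_euler_int _ q b alpha x q1 b0 b1 x1.
have iM1 := @integrable_euler_int _ q b (alpha - 1) x q1 b0 b1 x1.
rewrite -RintegralB// mulrAC -RintegralZl//; last exact: integrable_EFinB.
apply: eq_Rintegral => t /set_mem t01.
rewrite (powR_mulB1 alpha (onem_mul_powR_gt0 q0 x1 t01)).
by field.
Qed.

Lemma continuous_euler_integrand (R : realType) (q b c x t : R) :
  `|x| < 1 -> 0 < q -> 0 < t -> t < 1 ->
  {for t, continuous (fun t => (1 - t `^ q) `^ (- b) * (1 - x * t `^ q) `^ c)}.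
Proof.
move=> x1 q0 t0 t1.
have y : s `^ q @[s --> t] --> t `^ q by exact: cvg_powR_comp.
apply: cvgM; apply: cvg_powR_comp.
- by rewrite subr_gt0 powR_lt1.
- by apply: cvgB => //; exact: cvg_cst.
- by apply: onem_mul_powR_gt0 => //=; [exact: ltW|rewrite in_itv/= !ltW].
- by apply: cvgB; [exact: cvg_cst|apply: cvgM => //; exact: cvg_cst].
Qed.

(** Write u = 1 - t^q and v = 1 - x t^q. The derivative of t u^(1-b) v^(b-1) is
    u^(-b) v^(b-2) (u v - q (1-b) (1-x) t^q). Multiplying by x and using
    x u = v - (1 - x) and x t^q = 1 - v leaves only the weight u^(-b) times
    powers of v. *)
Lemma is_derive_euler_primitive (R : realType) (q b x t : R) :
  `|x| < 1 -> 0 < q -> 0 < t -> t < 1 ->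
  is_derive t 1 (fun t => x * t * (1 - t `^ q) `^ (1 - b) * (1 - x * t `^ q) `^ (b - 1))
    ((1 - t `^ q) `^ (- b) * (1 - x * t `^ q) `^ b
     - (1 - x) * ((1 - t `^ q) `^ (- b) * (1 - x * t `^ q) `^ (b - 1))
     - q * (1 - b) * (1 - x) *
       ((1 - t `^ q) `^ (- b) * (1 - x * t `^ q) `^ (b - 1 - 1)
        - (1 - t `^ q) `^ (- b) * (1 - x * t `^ q) `^ (b - 1))).
Proof.
move=> x1 q0 t0 t1.
have tq1 : t `^ q < 1 := powR_lt1 q0 t0 t1.
have u0 : 0 < 1 - t `^ q by rewrite subr_gt0.
have v0 : 0 < 1 - x * t `^ q.
  by apply: onem_mul_powR_gt0 => //=; [exact: ltW|rewrite in_itv/= !ltW].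
have dy : is_derive t 1 (fun t : R => t `^ q) (q * t `^ (q - 1)).
  exact: is_derive1_powR.
have du : is_derive t 1 (fun t : R => 1 - t `^ q) (- (q * t `^ (q - 1))).
  by apply: (is_derive_eq (is_deriveB (is_derive_cst (1 : R) t 1) dy)); rewrite sub0r.
have dv : is_derive t 1 (fun t : R => 1 - x * t `^ q) (- (x * (q * t `^ (q - 1)))).
  apply: (is_derive_eq (is_deriveB (is_derive_cst (1 : R) t 1) (is_deriveZ x dy))).
  by rewrite sub0r.
have duc := @is_derive_powR_comp _ (fun t => 1 - t `^ q) (1 - b) t _ u0 du.
have dvc := @is_derive_powR_comp _ (fun t => 1 - x * t `^ q) (b - 1) t _ v0 dv.
apply: (is_derive_eq
  (is_deriveM (is_deriveM (is_deriveZ x (is_derive_id t 1)) duc) dvc)).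
rewrite !fctE /GRing.scale/=.
have -> : 1 - b - 1 = - b by ring.
(* All powers are reduced to t^(q-1), u^(-b) and v^(b-2), after which the
   identity is polynomial. *)
have Y : t `^ q = t * t `^ (q - 1) by exact: powR_mulB1.
have U : (1 - t `^ q) `^ (1 - b) = (1 - t `^ q) * (1 - t `^ q) `^ (- b).
  by rewrite (powR_mulB1 _ u0); congr (_ * _ `^ _); ring.
rewrite (powR_mulB1 b v0) (powR_mulB1 (b - 1) v0) U.
move: ((1 - t `^ q) `^ (- b)) ((1 - x * t `^ q) `^ (b - 1 - 1)) => A B.
rewrite -[x *: t]/(x * t) Y; ring.
Qed.

(** Gauss's contiguity relation, as an integration by parts: the primitive
    t u^(1-b) v^(b-1) vanishes at t = 0 because of t and at t = 1 because of
    u^(1-b), as b < 1, so its derivative has integral 0. *)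
Lemma euler_int_contiguous (R : realType) (q b x : R) :
  1 < q -> 0 < b -> b < 1 -> `|x| < 1 ->
  euler_int q b b x - (1 - x) * euler_int q b (b - 1) x =
  q * (1 - b) * (1 - x) * (euler_int q b (b - 1 - 1) x - euler_int q b (b - 1) x).
Proof.
move=> q1 b0 b1 x1; have q0 : 0 < q by lra.
have i0 := @integrable_euler_int _ q b b x q1 b0 b1 x1.
have i1 := @integrable_euler_int _ q b (b - 1) x q1 b0 b1 x1.
have i2 := @integrable_euler_int _ q b (b - 1 - 1) x q1 b0 b1 x1.
pose G t := x * t * (1 - t `^ q) `^ (1 - b) * (1 - x * t `^ q) `^ (b - 1).
apply/eqP; rewrite -subr_eq0 /euler_int; apply/eqP.
rewrite -RintegralB// -!RintegralZl//; last exact: integrable_EFinB.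
have m01 : measurable (`[0, 1]%classic : set (measurableTypeR R)).
  exact: measurable_itv.
have iZ1 := integrable_EFinZl (1 - x) m01 i1.
have i21 := integrable_EFinB m01 i2 i1.
have iZ21 := integrable_EFinZl (q * (1 - b) * (1 - x)) m01 i21.
have i01 := integrable_EFinB m01 i0 iZ1.
rewrite -RintegralB// -RintegralB//.
transitivity (G 1 - G 0); last first.
  by rewrite /G !(mulr0, mul0r) powR1 subrr powR0 ?(mulr0, mul0r, subrr)// gt_eqF// subr_gt0.
apply: Rintegral_FTC_integrable => //.
- exact: integrable_EFinB.
- move=> t; rewrite in_itv/= => /andP[t0 t1].
  have cW c := @continuous_euler_integrand _ q b c x t x1 q0 t0 t1.
  rewrite /continuous_at; apply: cvgB.
    by apply: cvgB; [exact: cW|apply: cvgM; [exact: cvg_cst|exact: cW]].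
  by apply: cvgM; [exact: cvg_cst|apply: cvgB; exact: cW].
- move=> t; rewrite in_itv/= => /andP[t0 t1].
  exact: is_derive_euler_primitive.
- apply/continuous_within_itvP => //; split.
  + move=> t; rewrite in_itv/= => /andP[t0 t1].
    apply/differentiable_continuous/derivable1_diffP.
    by have [] := @is_derive_euler_primitive _ q b x t x1 q0 t0 t1.
  + have y0 : (t : R) `^ q @[t --> 0^'+] --> 0 by exact: powR_cvg0.
    rewrite /G; apply: cvgM; [apply: cvgM|].
    * apply: cvgM; first exact: cvg_cst.
      exact: cvg_at_right_filter.
    * rewrite powR0 ?gt_eqF//; apply: cvg_powR_comp; first by rewrite subr0.
      by apply: cvgB => //; exact: cvg_cst.
    * rewrite powR0 ?gt_eqF//; apply: cvg_powR_comp; first by rewrite mulr0 subr0.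
      by apply: cvgB; [exact: cvg_cst|apply: cvgM => //; exact: cvg_cst].
  (* At t = 1 the base u tends to 0, but its exponent 1 - b is positive. *)
  + have y1 : (t : R) `^ q @[t --> 1^'-] --> 1 `^ q.
      by apply: cvg_powR_comp => //; exact: cvg_at_left_filter.
    rewrite /G; apply: cvgM; [apply: cvgM|].
    * apply: cvgM; first exact: cvg_cst.
      exact: cvg_at_left_filter.
    * rewrite [X in _ --> X](_ : _ = 0); last first.
        by rewrite powR1 subrr powR0// gt_eqF// subr_gt0.
      apply: cvg_powR_comp0; first by rewrite subr_gt0.
        near=> t; rewrite subr_gt0.
        apply: powR_lt1 => //.
      rewrite [X in _ --> X](_ : _ = 1 - 1 `^ q); last by rewrite powR1 subrr.
      by apply: cvgB => //; exact: cvg_cst.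
    * apply: cvg_powR_comp.
        by rewrite powR1 mulr1 subr_gt0 (le_lt_trans (ler_norm _)).
      by apply: cvgB; [exact: cvg_cst|apply: cvgM => //; exact: cvg_cst].
Unshelve. all: by end_near. Qed.

(** The contiguity relation eliminates the exponent b - 2 from the derivative of
    the integral of the first kind, so that the integrals of both kinds
    form a closed first-order linear system. *)
Lemma is_derive_euler_int_contiguous (R : realType) (q b x : R) :
  1 < q -> 0 < b -> b < 1 -> `|x| < 1 -> x != 0 ->
  is_derive x 1 (euler_int q b (b - 1))
    ((euler_int q b b x / (1 - x) - euler_int q b (b - 1) x) / (q * x)).
Proof.
move=> q1 b0 b1 x1 xn0.
have x1' : 1 - x != 0 by rewrite gt_eqF// subr_gt0 (le_lt_trans (ler_norm _)).
have qn0 : q != 0 by rewrite gt_eqF//; lra.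
apply: (is_derive_eq (@is_derive_euler_int _ q b (b - 1) x q1 b0 b1 x1 xn0)).
have -> : euler_int q b b x = (1 - x) * euler_int q b (b - 1) x +
    q * (1 - b) * (1 - x) * (euler_int q b (b - 1 - 1) x - euler_int q b (b - 1) x).
  by rewrite -euler_int_contiguous// addrC subrK.
move: (euler_int q b (b - 1) x) (euler_int q b (b - 1 - 1) x) => B B2.
by field; rewrite xn0 x1' qn0.
Qed.

(** * The elliptic integrals as Euler integrals *)

Lemma ellE_euler_int (R : realType) (p q k : R) : 1 < q -> 0 <= k < 1 ->
  ellE p q (k `^ q^-1) = euler_int q p^-1 p^-1 k.
Proof.
move=> q1 /andP[k0 k1]; have q0 : 0 < q by lra.
have kq : (k `^ q^-1) `^ q = k by rewrite -powRrM mulVf ?gt_eqF// powRr1.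
rewrite /ellE /euler_int kq; apply: eq_Rintegral => t /set_mem t01.
have /andP[y0 y1] := powR_itv01 (ltW q0) t01.
have v0 : 0 < 1 - k * t `^ q by apply: onem_mul_powR_gt0 => //; [exact: ltW|rewrite ger0_norm].
rewrite powRM ?invr_ge0 ?(ltW v0) ?subr_ge0//.
by rewrite mulrC -(powR_inv1 (a := 1 - t `^ q)) ?subr_ge0// -powRrM mulN1r.
Qed.

Lemma ellK_euler_int (R : realType) (p q k : R) : 1 < q -> 0 <= k < 1 ->
  ellK p q (k `^ q^-1) = euler_int q p^-1 (p^-1 - 1) k.
Proof.
move=> q1 /andP[k0 k1]; have q0 : 0 < q by lra.
have kq : (k `^ q^-1) `^ q = k by rewrite -powRrM mulVf ?gt_eqF// powRr1.
rewrite /ellK /euler_int kq; apply: eq_Rintegral => t _.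
by rewrite invfM -!powRN opprB.
Qed.

Lemma euler_int0 (R : realType) (p q alpha : R) :
  euler_int q p^-1 alpha 0 = pi_pq p q / 2.
Proof.
rewrite /pi_pq mulrC mulKf// /euler_int; apply: eq_Rintegral => t _.
by rewrite mul0r subr0 powR1 mulr1 powRN.
Qed.

(** * Constancy of the Legendre form *)

Definition legendre_form (R : realType) (p q x : R) : R :=
  p * euler_int q p^-1 p^-1 x * euler_int p q^-1 (q^-1 - 1) x
  - q * euler_int q p^-1 (p^-1 - 1) x * euler_int p q^-1 q^-1 x.

Lemma is_derive_legendre_form (R : realType) (p q x : R) :
  1 < p -> 1 < q -> `|x| < 1 -> x != 0 -> is_derive x 1 (legendre_form p q) 0.
Proof.
move=> p1 q1 x1 xn0.
have x1' : 1 - x != 0 by rewrite gt_eqF// subr_gt0 (le_lt_trans (ler_norm _)).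
have qn0 : q != 0 by rewrite gt_eqF//; lra.
have pn0 : p != 0 by rewrite gt_eqF//; lra.
have [a0 a1] : 0 < q^-1 /\ q^-1 < 1 by rewrite invr_gt0 invf_lt1; lra.
have [b0 b1] : 0 < p^-1 /\ p^-1 < 1 by rewrite invr_gt0 invf_lt1; lra.
have dA := is_derive_euler_int p^-1 q1 b0 b1 x1 xn0.
have dB := is_derive_euler_int_contiguous q1 b0 b1 x1 xn0.
have dC := is_derive_euler_int q^-1 p1 a0 a1 x1 xn0.
have dD := is_derive_euler_int_contiguous p1 a0 a1 x1 xn0.
apply: (is_derive_eq (is_deriveB (is_deriveM (is_deriveZ p dA) dD)
  (is_deriveM (is_deriveZ q dB) dC))).
rewrite /GRing.scale/= -[p *: _]/(p * _) -[q *: _]/(q * _).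
move: (euler_int q p^-1 p^-1 x) (euler_int q p^-1 (p^-1 - 1) x)
  (euler_int p q^-1 q^-1 x) (euler_int p q^-1 (q^-1 - 1) x) => A B C D.
(* Cancelling this factor p beforehand keeps the common denominator small
   enough for the final normalisation. *)
have -> : p * A * ((C / (1 - x) - D) / (p * x)) = A * (C / (1 - x) - D) / x.
  by field; rewrite xn0 x1' pn0.
by field; rewrite xn0 x1' qn0 pn0.
Qed.

(** The formulas for the derivative divide by x and say nothing at 0, but the
    form is still continuous there, by differentiation under the integral
    sign; this is enough for the mean value theorem on [0, k]. *)
Lemma legendre_form_cst (R : realType) (p q k : R) :
  1 < p -> 1 < q -> 0 <= k < 1 -> legendre_form p q k = legendre_form p q 0.
Proof.
move=> p1 q1 /andP[]; rewrite le_eqVlt => /predU1P[<-//|k0] k1.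
have [a0 a1] : 0 < q^-1 /\ q^-1 < 1 by rewrite invr_gt0 invf_lt1; lra.
have [b0 b1] : 0 < p^-1 /\ p^-1 < 1 by rewrite invr_gt0 invf_lt1; lra.
have [||c _] := @MVT R (legendre_form p q) (cst 0) 0 k k0.
- move=> x; rewrite in_itv/= => /andP[x0 xk].
  by apply: is_derive_legendre_form; rewrite ?gt_eqF// gtr0_norm//; lra.
- apply: derivable_within_continuous => x; rewrite in_itv/= => /andP[x0 xk].
  have x1 : `|x| < 1 by rewrite ger0_norm//; lra.
  have [dA _] := @is_derive_euler_int_under _ q p^-1 p^-1 x q1 b0 b1 x1.
  have [dB _] := @is_derive_euler_int_under _ q p^-1 (p^-1 - 1) x q1 b0 b1 x1.
  have [dC _] := @is_derive_euler_int_under _ p q^-1 q^-1 x p1 a0 a1 x1.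
  have [dD _] := @is_derive_euler_int_under _ p q^-1 (q^-1 - 1) x p1 a0 a1 x1.
  have := derivableB (derivableM (derivableZ (k:=p) dA) dD)
                     (derivableM (derivableZ (k:=q) dB) dC).
  exact.
by rewrite mul0r => /eqP; rewrite subr_eq0 => /eqP.
Qed.

Theorem theorem1p3 (R : realType) (p q k : R)
    (hp : 1 < p) (hq : 1 < q) (hk0 : 0 <= k) (hk1 : k < 1) :
  p * ellE p q (k `^ q^-1) * ellK q p (k `^ p^-1)
  - q * ellK p q (k `^ q^-1) * ellE q p (k `^ p^-1)
  = (p - q) * pi_pq p q * pi_pq q p / 4.
Proof.
have k01 : 0 <= k < 1 by rewrite hk0.
rewrite !ellE_euler_int// !ellK_euler_int//.
have := legendre_form_cst hp hq k01; rewrite /legendre_form !euler_int0 => ->.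
move: (pi_pq p q) (pi_pq q p) => P Q.
by field.
Qed.
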